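(* Let $d\ge 1$ and let $\pmb{\alpha}=(\alpha_1,\dots,\alpha_d)\in\mathbb{R}^d$ be such that $\alpha_1,\dots,\alpha_d,1$ are linearly independent over $\mathbb{Q}$. Let $(q_\nu)_{\nu\ge1}$ be the sequence of denominators of the best simultaneous approximations to $\pmb\alpha$, and let $(L_\nu)_{\nu\ge 1}$ be the sequence of values of the linear form at the best approximations to $\pmb\alpha$ in the sense of the linear form. Then the following three statements are equivalent: (i) $\pmb{\alpha}$ is badly approximable; (ii) $\sup_{j} \frac{q_{j+1}}{q_j} < \infty$; (iii) $\inf_{j} \frac{L_{j+1}}{L_j} >0$.
   Context: For real $x$, $\|x\|=\min_{a\in\mathbb{Z}}|x-a|$. $\pmb\alpha\in\mathbb{R}^d$ is badly approximable if $\inf_{q\in\mathbb{Z}_+} q^{1/d}\max_{1\le j\le d}\|q\alpha_j\|>0$, where $\mathbb{Z}_+$ is the set of positive integers. Best simultaneous approximations: $q_1<q_2<\dots$ is the increasing sequence of all positive integers $q_\nu$ such that $\max_{1\le j\le d}\|q_\nu\alpha_j\|<\max_{1\le j\le d}\|q\alpha_j\|$ for all positive integers $q<q_\nu$ (so $q_1=1$). Best approximations in the sense of the linear form: for $\pmb m=(m_1,\dots,m_d)\in\mathbb{Z}^d$ write $|\pmb m|_\infty=\max_j|m_j|$ and $L(\pmb m)=\|m_1\alpha_1+\dots+m_d\alpha_d\|$. Put $M_1=1$ and $L_1=\min\{L(\pmb m):|\pmb m|_\infty=1\}$. Inductively, $M_{\nu+1}$ is the smallest positive integer $M$ such that there is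 $\pmb m\in\mathbb{Z}^d$ with $|\pmb m|_\infty=M$ and $L(\pmb m)<L_\nu$, and $L_{\nu+1}=\min\{L(\pmb m): |\pmb m|_\infty=M_{\nu+1}\}$. Thus $M_1<M_2<\dots$ and $L_1>L_2>\dots$. *)

(* Defs.v *)
From HB Require Import structures.
From mathcomp Require Import all_boot all_order all_algebra.
From mathcomp Require Import all_classical all_reals all_analysis.

Set Implicit Arguments.
Unset Strict Implicit.
Unset Printing Implicit Defensive.

Import Order.TTheory GRing.Theory Num.Theory.

Local Open Scope classical_set_scope.
Local Open Scope ring_scope.

(* Every minimum of reals below is written [inf]: the set is the (nonempty)
   family of distances from a real to the integers, or is indexed by a finite
   nonempty set of integer vectors, so it is attained. *)

Definition dist_int (R : realType) (x : R) : R :=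
  inf [set `|x - a%:~R| | a in [set: int]].

(* The default value 0 is harmless, since all the terms are nonnegative. *)
Definition sim_dist (R : realType) (d : nat) (alpha : 'rV[R]_d) (q : nat) : R :=
  \big[Num.max/0]_(j < d) dist_int (q%:R * alpha 0 j).

Definition badly_approximable (R : realType) (d : nat) (alpha : 'rV[R]_d) :
    Prop :=
  0 < inf [set q%:R `^ (d%:R^-1) * sim_dist alpha q | q in [set q | (0 < q)%N]].

Definition Q_independent_with_1 (R : realType) (d : nat) (alpha : 'rV[R]_d) :
    Prop :=
  forall (c : 'rV[rat]_d) (c0 : rat),
    \sum_(j < d) ratr (c 0 j) * alpha 0 j + ratr c0 * 1 = 0 ->
    c = 0 /\ c0 = 0.

(* Junk value 0 if no natural number satisfies [P]. *)
Definition least (P : nat -> Prop) : nat :=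
  xget 0%N [set n | P n /\ forall m, P m -> (n <= m)%N].

Definition best_sim_denom (R : realType) (d : nat) (alpha : 'rV[R]_d)
    (q : nat) : Prop :=
  (0 < q)%N /\
  forall q', (0 < q')%N -> (q' < q)%N -> sim_dist alpha q < sim_dist alpha q'.

(* The increasing enumeration of [best_sim_denom alpha], indexed from 0.  This
   set is infinite when alpha_1, ..., alpha_d, 1 are Q-independent. *)
Fixpoint best_q (R : realType) (d : nat) (alpha : 'rV[R]_d) (nu : nat) : nat :=
  if nu is nu'.+1
  then least (fun q => (best_q alpha nu' < q)%N /\ best_sim_denom alpha q)
  else least (best_sim_denom alpha).

Definition supnorm (d : nat) (m : 'rV[int]_d) : nat :=
  (\max_(j < d) `|m 0%R j|)%N.

Definition linear_form (R : realType) (d : nat) (alpha : 'rV[R]_d)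
    (m : 'rV[int]_d) : R :=
  dist_int (\sum_(j < d) (m 0 j)%:~R * alpha 0 j).

Definition min_linear_form (R : realType) (d : nat) (alpha : 'rV[R]_d)
    (M : nat) : R :=
  inf [set linear_form alpha m | m in [set m | supnorm m = M]].

(* Indexed from 0: [best_M alpha 0] is M_1. *)
Fixpoint best_M (R : realType) (d : nat) (alpha : 'rV[R]_d) (nu : nat) : nat :=
  if nu is nu'.+1
  then least (fun M => (0 < M)%N /\ exists m : 'rV[int]_d, supnorm m = M /\
         linear_form alpha m < min_linear_form alpha (best_M alpha nu'))
  else 1%N.

Definition best_L (R : realType) (d : nat) (alpha : 'rV[R]_d) (nu : nat) : R :=
  min_linear_form alpha (best_M alpha nu).

(* Main.v *)
Require Import Defs.
From HB Require Import structures.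
From mathcomp Require Import all_boot all_order all_algebra.
From mathcomp Require Import all_classical all_reals all_analysis.
From mathcomp Require Import lra ring zify.

Set Implicit Arguments.
Unset Strict Implicit.
Unset Printing Implicit Defensive.

Import Order.TTheory GRing.Theory Num.Theory.

Local Open Scope classical_set_scope.
Local Open Scope ring_scope.

(** Write zeta(q) for the simultaneous approximation error of the denominator
q, and L(m) for the value of the linear form at m.  Bad approximability has a
simultaneous form, q zeta(q)^d bounded below ([bad_simultaneous]), and a dual
form, |m|^d L(m) bounded below ([bad_linear_form]).  The theorem follows from
the cycle of implications
  [bad_simultaneous] -> [q_ratio_bounded] -> [bad_linear_form]
    -> [L_ratio_bounded_below] -> [bad_simultaneous],
in which each arrow is short; the transference principle for badly
approximable vectors is a consequence and not an ingredient.

The pigeonhole principle gives q_(j+1) zeta(q_j)^d <= 2^d and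
M_(j+1)^d L_j <= 2^d ([best_q_dirichlet], [best_M_dirichlet]).  Compared with
a lower bound for q_j zeta(q_j)^d, respectively M_(j+1)^d L_(j+1), these bound
the ratios; that is the first and the third arrow.

The other two arrows use the duality between the two problems.  If p is the
integer vector nearest to q alpha and p0 the integer nearest to m.alpha, then
  q (m.alpha - p0) = m.(q alpha - p) + (m.p - q p0),
where the last bracket is an integer.  Either it vanishes, so that
q L(m) <= d |m| zeta(q), or it has modulus at least 1.  Hence as soon as
q L(m) <= 1/2, the inequality q L(m) <= d |m| zeta(q) holds in both cases
([pairing_bound]).  For the second arrow, fix m and take the last best
denominator q_j with q_j L(m) < 1/2.  As q_(j+1) / q_j is bounded, q_j L(m) is
also bounded below, hence so is |m| zeta(q_j); together with
q_(j+1) zeta(q_j)^d <= 2^d and q_(j+1) L(m) >= 1/2 this bounds |m|^d L(m)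
below.  For the fourth, fix q and exchange the roles: take the first L_(j+1)
that is at most 1/(2q). *)

(** * Least natural numbers and nearest integers *)

Lemma exists_least (P : nat -> Prop) (n : nat) :
  P n -> P (least P) /\ forall m, P m -> (least P <= m)%N.
Proof.
move=> Pn; rewrite /least; set S : set nat := [set _ | _].
suff : S (xget 0%N S) by [].
apply: xgetPex.
have ex : exists n, `[< P n >] by exists n; apply/asboolP.
exists (ex_minn ex); case: ex_minnP => k /asboolP Pk min; split=> // m Pm.
exact/min/asboolP.
Qed.

Lemma dist_int_le (R : realType) (x : R) (a : int) : dist_int x <= `|x - a%:~R|.
Proof.
by apply: ge_inf; [exists 0 => _ [b _ <-]; exact: normr_ge0 | exists a].
Qed.

Lemma dist_int_attained (R : realType) (x : R) :
  exists a : int, dist_int x = `|x - a%:~R|.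
Proof.
have /andP[lo hi] := floor_itv x; set n := Num.floor x in lo hi *.
have attain a : (forall b : int, `|x - a%:~R| <= `|x - b%:~R|) ->
    dist_int x = `|x - a%:~R|.
  move=> amin; apply/eqP; rewrite eq_le dist_int_le /=.
  by apply: lb_le_inf; [exists `|x - a%:~R|, a | move=> _ [b _ <-]].
have hb (b : int) : b%:~R <= n%:~R :> R \/ (n + 1)%:~R <= b%:~R :> R.
  by rewrite !ler_int; lia.
rewrite intrD in hi hb.
have [half|half] := lerP (x - n%:~R) (2^-1).
  exists n; apply: attain => b; rewrite ger0_norm ?subr_ge0//.
  by case: (hb b) => hb'; [apply: le_trans (ler_norm _)|
    rewrite distrC; apply: le_trans (ler_norm _)]; lra.
exists (n + 1); apply: attain => b; rewrite distrC intrD ger0_norm; last by lra.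
by case: (hb b) => hb'; [apply: le_trans (ler_norm _)|
  rewrite distrC; apply: le_trans (ler_norm _)]; lra.
Qed.

Lemma dist_int_ge0 (R : realType) (x : R) : 0 <= dist_int x.
Proof. by have [a ->] := dist_int_attained x. Qed.

Lemma dist_intN (R : realType) (x : R) : dist_int (- x) = dist_int x.
Proof.
apply/eqP; rewrite eq_le; apply/andP; split.
  have [a ->] := dist_int_attained x.
  by rewrite -normrN opprB addrC -[a]opprK intrN dist_int_le.
have [a ->] := dist_int_attained (- x).
by rewrite -normrN opprD opprK -intrN dist_int_le.
Qed.

(** The box principle behind both theorems of Dirichlet: cut the unit cube of
    fractional parts into n^|I| equal boxes; two of the points share a box. *)
Lemma dist_int_pigeonhole (R : realType) (I T : finType) (n : nat)
    (x : T -> I -> R) :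
  (0 < n)%N -> (n ^ #|I| < #|T|)%N ->
  exists t t', t != t' /\ forall i, dist_int (x t i - x t' i) <= n%:R^-1.
Proof.
case: n => // n _ card_lt.
pose frac t i : R := x t i - (Num.floor (x t i))%:~R.
pose k t i := Num.floor (n.+1%:R * frac t i).
have frac_itv t i : 0 <= frac t i < 1.
  by have := floor_itv (x t i); rewrite intrD /frac; lra.
have k_itv t i : (0 <= k t i < n.+1)%R.
  have /andP[f0 f1] := frac_itv t i.
  rewrite /k floor_ge0 floor_lt_int mulr_ge0//=.
  by rewrite -[ltRHS]mulr1 ltr_pM2l.
pose cell t : {ffun I -> 'I_n.+1} := [ffun i => inord `|k t i|%N].
have /injectivePn[t [t' tt' eq_cell]] : ~~ injectiveb cell.
  apply/negP => /injectiveP /leq_card.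
  by rewrite card_ffun card_ord leqNgt card_lt.
exists t, t'; split=> // i.
have eq_k : k t i = k t' i.
  have kt := k_itv t i; have kt' := k_itv t' i.
  have /ffunP/(_ i)/(congr1 val) := eq_cell; rewrite !ffunE /= !inordK; lia.
apply: le_trans (dist_int_le _ (Num.floor (x t i) - Num.floor (x t' i))) _.
rewrite intrB opprB.
have -> : x t i - x t' i + ((Num.floor (x t' i))%:~R - (Num.floor (x t i))%:~R)
   = frac t i - frac t' i by rewrite /frac; lra.
have n0 : (0 : R) < n.+1%:R by [].
rewrite -(ler_pM2l n0) mulfV ?gt_eqF// -{1}(ger0_norm (ltW n0)) -normrM mulrBr.
have := floor_itv (n.+1%:R * frac t i); have := floor_itv (n.+1%:R * frac t' i).
rewrite -/(k t i) -/(k t' i) eq_k intrD ler_norml; lra.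
Qed.

(** * The two approximation functions *)

Lemma leq_supnorm (d : nat) (m : 'rV[int]_d) (j : 'I_d) :
  (`|m 0%R j| <= supnorm m)%N.
Proof. by rewrite /supnorm; apply: leq_bigmax. Qed.

Lemma supnorm_leP (d : nat) (m : 'rV[int]_d) (N : nat) :
  reflect (forall j, (`|m 0%R j| <= N)%N) (supnorm m <= N)%N.
Proof.
by rewrite /supnorm; apply: (iffP (bigmax_leqP _ _ _)) => [h j|h j _]; apply: h.
Qed.

Lemma supnorm_gt0 (d : nat) (m : 'rV[int]_d) : (0 < supnorm m)%N = (m != 0).
Proof.
rewrite lt0n; congr (~~ _); apply/eqP/eqP => [m0|->]; last first.
  by apply/eqP; rewrite -leqn0; apply/supnorm_leP => j; rewrite mxE.
apply/rowP => j; rewrite mxE; have := leq_supnorm m j.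
by rewrite m0 leqn0 absz_eq0 => /eqP ->.
Qed.

Lemma linear_form_gt0 (R : realType) (d : nat) (alpha : 'rV[R]_d)
    (m : 'rV[int]_d) :
  Q_independent_with_1 alpha -> m != 0 -> 0 < linear_form alpha m.
Proof.
move=> indep; apply: contraNT; rewrite /linear_form.
have [a ->] := dist_int_attained (\sum_(j < d) (m 0 j)%:~R * alpha 0 j).
rewrite normr_gt0 negbK => /eqP form0.
have [|mrat0 _] := indep (map_mx intr m) (- a)%:~R.
  rewrite mulr1 ratr_int intrN -[RHS]form0; congr (_ - _).
  by apply: eq_bigr => j _; rewrite mxE ratr_int.
apply/eqP/rowP => j; have /rowP/(_ j) := mrat0.
by rewrite !mxE => /eqP; rewrite intr_eq0 => /eqP.
Qed.

Lemma min_linear_form_le (R : realType) (d : nat) (alpha : 'rV[R]_d)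
    (m : 'rV[int]_d) :
  min_linear_form alpha (supnorm m) <= linear_form alpha m.
Proof.
by apply: ge_inf; [exists 0 => _ [b _ <-]; exact: dist_int_ge0|exists m].
Qed.

(** Only finitely many integer vectors have sup norm M, and there is one as
    soon as d > 0, so the infimum is a minimum. *)
Lemma min_linear_form_attained (R : realType) (d : nat) (alpha : 'rV[R]_d)
    (M : nat) :
  (0 < d)%N ->
  exists2 m, supnorm m = M & min_linear_form alpha M = linear_form alpha m.
Proof.
case: d alpha => // d alpha _.
pose shift (f : {ffun 'I_d.+1 -> 'I_(M + M).+1}) : 'rV[int]_d.+1 :=
  \row_j ((f j)%:Z - M%:Z).
have shift_onto m : supnorm m = M -> exists f, shift f = m.
  move=> mM; have mj j := leq_supnorm m j; rewrite mM in mj.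
  exists [ffun j => inord `|m 0 j + M%:Z|]; apply/rowP => j.
  by rewrite mxE ffunE inordK; have := mj j; lia.
have constM : supnorm (const_mx M%:Z : 'rV_d.+1) = M.
  apply/eqP; rewrite eqn_leq; apply/andP; split.
    by apply/supnorm_leP => j; rewrite mxE absz_nat.
  by have := leq_supnorm (const_mx M%:Z : 'rV_d.+1) 0; rewrite mxE.
have [f0 f0E] := shift_onto _ constM.
have f0M : supnorm (shift f0) == M by rewrite f0E constM.
have := @arg_minP _ _ _ f0 [pred f | supnorm (shift f) == M]
  (fun f => linear_form alpha (shift f)) f0M.
case=> f /eqP fM fmin; exists (shift f) => //.
apply/eqP; rewrite eq_le -{1}fM min_linear_form_le /=.
apply: lb_le_inf; first by exists (linear_form alpha (shift f)), (shift f).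
move=> _ [m mM <-]; have [g gm] := shift_onto m mM.
by rewrite -gm; apply: fmin; rewrite /= gm mM.
Qed.

Lemma min_linear_form_gt0 (R : realType) (d : nat) (alpha : 'rV[R]_d)
    (M : nat) :
  (0 < d)%N -> Q_independent_with_1 alpha -> (0 < M)%N ->
  0 < min_linear_form alpha M.
Proof.
move=> d0 indep M0; have [m mM ->] := min_linear_form_attained alpha M d0.
by apply: linear_form_gt0; rewrite // -supnorm_gt0 mM.
Qed.

Lemma dist_int_le_sim_dist (R : realType) (d : nat) (alpha : 'rV[R]_d)
    (q : nat) (j : 'I_d) :
  dist_int (q%:R * alpha 0 j) <= sim_dist alpha q.
Proof. exact: le_bigmax. Qed.

(** The first coordinate of the error is the linear form at q times the first
    basis vector. *)
Lemma sim_dist_gt0 (R : realType) (d : nat) (alpha : 'rV[R]_d) (q : nat) :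
  (0 < d)%N -> Q_independent_with_1 alpha -> (0 < q)%N -> 0 < sim_dist alpha q.
Proof.
case: d alpha => // d alpha _ indep q0.
apply: lt_le_trans (dist_int_le_sim_dist alpha q 0).
pose m : 'rV[int]_d.+1 := q%:Z *: delta_mx 0 0.
have <- : linear_form alpha m = dist_int (q%:R * alpha 0 0).
  rewrite /linear_form (bigD1 0) //= !mxE !eqxx mulr1 big1 ?addr0//.
  by move=> j /negPf j0; rewrite !mxE j0 mulr0 mul0r.
apply: linear_form_gt0 => //; apply/eqP => /rowP/(_ 0).
by rewrite !mxE !eqxx mulr1; lia.
Qed.

(** * Dirichlet's theorems and the duality inequality *)

Lemma dirichlet_simultaneous (R : realType) (d : nat) (alpha : 'rV[R]_d)
    (N : nat) :
  (0 < N)%N ->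
  exists2 q, (0 < q <= N ^ d)%N & sim_dist alpha q <= N%:R^-1.
Proof.
move=> N0.
have [||t [t' [tt' close]]] := @dist_int_pigeonhole R 'I_d 'I_(N ^ d).+1 N
    (fun t j => t%:R * alpha 0 j) => //; first by rewrite !card_ord.
wlog lt_t : t t' tt' close / (t < t')%N.
  move=> th; have [lt_t|lt_t|/val_inj eq_t] := ltngtP t t'.
  - exact: (th t t').
  - apply: (th t' t) => //; first by rewrite eq_sym.
    by move=> j; rewrite -dist_intN opprB.
  - by rewrite eq_t eqxx in tt'.
exists (t' - t)%N; first by have := ltn_ord t'; lia.
apply/bigmax_leP; split=> [|j _]; first by rewrite invr_ge0.
by rewrite natrB 1?ltnW// mulrBl -dist_intN opprB close.
Qed.

Lemma dirichlet_linear_form (R : realType) (d : nat) (alpha : 'rV[R]_d)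
    (N : nat) :
  (0 < d)%N -> (0 < N)%N ->
  exists2 M, (0 < M <= N)%N & min_linear_form alpha M <= (N%:R ^+ d)^-1.
Proof.
move=> d0 N0.
have [||t [t' [tt' close]]] :=
  @dist_int_pigeonhole R unit {ffun 'I_d -> 'I_N.+1} (N ^ d)
    (fun t _ => \sum_(j < d) (t j)%:R * alpha 0 j).
- by rewrite expn_gt0 N0.
- by rewrite card_unit expn1 card_ffun !card_ord ltn_exp2r.
pose m : 'rV[int]_d := \row_j ((t j)%:Z - (t' j)%:Z).
exists (supnorm m); last first.
  rewrite -natrX; 
  apply: le_trans (min_linear_form_le _ _) (le_trans _ (close tt)).
  rewrite /linear_form -sumrB le_eqVlt; apply/orP; left.
  apply/eqP; congr dist_int.
  by apply: eq_bigr => j _; rewrite mxE intrB mulrBl.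
apply/andP; split.
  rewrite supnorm_gt0; apply: contra tt' => /eqP/rowP m0; apply/eqP/ffunP => j.
  by apply: val_inj => /=; have := m0 j; rewrite !mxE => /subr0_eq [].
by apply/supnorm_leP => j; rewrite mxE; have := ltn_ord (t j);
  have := ltn_ord (t' j); lia.
Qed.

(** The inequality that links the two problems.  With p and p0 the nearest
    integers, q (m.alpha - p0) and m.(q alpha - p) differ by an integer n.  If
    n = 0, the bound is immediate.  Otherwise 1 <= q L(m) + d |m| zeta(q), and
    q L(m) <= 1/2 makes the last term at least 1/2. *)
Lemma pairing_bound (R : realType) (d : nat) (alpha : 'rV[R]_d) (q : nat)
    (m : 'rV[int]_d) :
  q%:R * linear_form alpha m <= 2^-1 ->
  q%:R * linear_form alpha m <= d%:R * (supnorm m)%:R * sim_dist alpha q.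
Proof.
have [p0 p0E] := dist_int_attained (\sum_(j < d) (m 0 j)%:~R * alpha 0 j).
rewrite /linear_form p0E.
set S := \sum_(j < d) _.
have [p pE] : exists p : 'I_d -> int, forall j,
    dist_int (q%:R * alpha 0 j) = `|q%:R * alpha 0 j - (p j)%:~R|.
  by have [p pE] := choice (fun j => dist_int_attained (q%:R * alpha 0 j));
     exists p.
pose E : R := \sum_(j < d) (m 0 j)%:~R * (q%:R * alpha 0 j - (p j)%:~R).
have E_le : `|E| <= d%:R * (supnorm m)%:R * sim_dist alpha q.
  rewrite -mulrA -[d in d%:R]card_ord mulr_natl -sumr_const.
  apply: le_trans (ler_norm_sum _ _ _) (ler_sum _ _) => j _.
  rewrite normrM -pE ler_pM ?dist_int_ge0 ?dist_int_le_sim_dist//.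
  by rewrite -intr_norm -[leRHS]mulrz_nat ler_int; have := leq_supnorm m j; lia.
pose n : int := \sum_(j < d) m 0 j * p j - q%:Z * p0.
have qE : q%:R * (S - p0%:~R) = E + n%:~R.
  rewrite /n /E intrB intrM rmorph_sum /= addrA -big_split /= mulrBr mulr_sumr.
  congr (_ - _); apply: eq_bigr => j _; rewrite intrM; ring.
have -> : q%:R * `|S - p0%:~R| = `|E + n%:~R| by rewrite -qE normrM normr_nat.
have [->|n0] := eqVneq n 0; first by rewrite addr0.
have n1 : 1 <= `|n%:~R| :> R by rewrite -intr_norm (ler_int _ 1); lia.
have := ler_normB (E + n%:~R) E; rewrite addrAC subrr add0r; lra.
Qed.

(** * Sequences of record minima *)

(** Common form of the two sequences of best approximations: each term is the
    first place where f takes a smaller value than at the previous term. *)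
Definition record_minima (R : realType) (f : nat -> R) (u : nat -> nat) :
    Prop :=
  u 0%N = 1%N /\
  forall j, [/\ (0 < u j.+1)%N, f (u j.+1) < f (u j)
    & forall n, (0 < n < u j.+1)%N -> f (u j) <= f n].

Lemma record_minima_lt (R : realType) (f : nat -> R) (u : nat -> nat)
    (j : nat) :
  record_minima f u -> (u j < u j.+1)%N.
Proof.
move=> [u0 hu]; have [uj1 fj1 _] := hu j; rewrite ltn_neqAle; apply/andP; split.
  by apply/eqP => e; rewrite e ltxx in fj1.
case: j uj1 fj1 => [|j] uj1 fj1; first by rewrite u0.
have [_ fj min] := hu j; rewrite leqNgt; apply/negP => ltu.
by have := min _ (introT andP (conj uj1 ltu)); lra.
Qed.

Lemma record_minima_gt (R : realType) (f : nat -> R) (u : nat -> nat)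
    (j : nat) :
  record_minima f u -> (j < u j)%N.
Proof.
move=> hu; elim: j => [|j IH]; first by rewrite hu.1.
exact: leq_ltn_trans IH (record_minima_lt j hu).
Qed.

Lemma exists_smaller_value (R : realType) (f : nat -> R) (n : nat) :
  (forall k, (0 < k)%N -> 0 < f k) ->
  (forall N, (0 < N)%N -> exists2 k, (0 < k)%N & f k <= N%:R^-1) ->
  (0 < n)%N -> exists2 k, (0 < k)%N & f k < f n.
Proof.
move=> f_gt0 f_small n0; have fn0 := f_gt0 _ n0.
have lt_bound := archi_boundP (ltW (etrans (invr_gt0 (f n)) fn0)).
have [|k k0 fk] := f_small (Num.bound (f n)^-1).
  by rewrite -(ltr0n R); apply: lt_trans lt_bound; rewrite invr_gt0.
exists k => //; apply: le_lt_trans fk _.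
by rewrite invf_plt// posrE; apply: lt_trans lt_bound; rewrite invr_gt0.
Qed.

(** * Best approximations *)

Section BestApproximations.
Context (R : realType) (d : nat) (alpha : 'rV[R]_d).
Hypothesis d_gt0 : (0 < d)%N.
Hypothesis indep : Q_independent_with_1 alpha.

(** A best denominator beats all smaller denominators, a record only the
    preceding record.  The two agree because the first denominator with a
    smaller error than a best q is itself best.  Dirichlet's theorem and the
    positivity of the errors provide such a denominator. *)
Lemma best_q_record_minima :
  record_minima (sim_dist alpha) (best_q alpha).
Proof.
pose zeta := sim_dist alpha.
have denom1 : best_sim_denom alpha 1 by split=> // q'; lia.
pose next q r := (q < r)%N /\ best_sim_denom alpha r.
have next_le q : best_sim_denom alpha q -> forall n, (0 < n)%N ->
    zeta n < zeta q ->
    exists2 r, (r <= n)%N & next q r.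
  move=> [q0 qmin] n n0 lt_n.
  have [] := @exists_least (fun r => (0 < r)%N /\ zeta r < zeta q) n
    (conj n0 lt_n).
  set r := least _ => -[r0 lt_r] rmin; exists r; first exact: rmin.
  split.
    rewrite ltnNge leq_eqVlt; apply/negP => /orP[/eqP e|/(qmin _ r0)].
      by rewrite e ltxx in lt_r.
    by rewrite -/(zeta q) -/(zeta r); lra.
  split=> // q' q'0 lt_q'; apply: lt_le_trans lt_r _.
  rewrite leNgt; apply/negP => lt_z.
  by have := rmin q' (conj q'0 lt_z); rewrite leqNgt lt_q'.
have ex_next q : best_sim_denom alpha q -> exists r, next q r.
  move=> den_q; have q0 := den_q.1.
  have [||n n0 lt_n] := @exists_smaller_value R zeta q _ _ q0.
  - by move=> k; apply: sim_dist_gt0.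
  - move=> N N0; have [k /andP[k0 _]] := dirichlet_simultaneous alpha N0.
    by exists k.
  by have [r _] := next_le q den_q n n0 lt_n; exists r.
have best j : best_sim_denom alpha (best_q alpha j).
  elim: j => [|j IH] /=; first by have [] := exists_least denom1.
  by have [r /exists_least[[]]] := ex_next _ IH.
split.
  have [[q0 _] /(_ _ denom1) q1] := exists_least denom1.
  by apply/eqP; rewrite /= eqn_leq q1.
move=> j; have [r /exists_least[]] := ex_next _ (best j).
rewrite -/(best_q alpha j.+1) => -[lt_q [q0 qmin]] qleast; split=> //.
  by apply: qmin => //; have [] := best j.
move=> n /andP[n0 lt_n]; rewrite leNgt; apply/negP => lt_zeta.
have [s le_s /qleast] := next_le _ (best j) n n0 lt_zeta; lia.
Qed.

Lemma best_M_record_minima :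
  record_minima (min_linear_form alpha) (best_M alpha).
Proof.
pose next M k := (0 < k)%N /\ exists m : 'rV[int]_d,
  supnorm m = k /\ linear_form alpha m < min_linear_form alpha M.
have next_lt M k : min_linear_form alpha k < min_linear_form alpha M ->
    (0 < k)%N -> next M k.
  have [m mk ->] := min_linear_form_attained alpha k d_gt0.
  by move=> lt_k k0; split=> //; exists m.
have ex_next M : (0 < M)%N -> exists k, next M k.
  move=> M0.
  have [||k k0 lt_k] :=
    @exists_smaller_value R (min_linear_form alpha) M _ _ M0.
  - by move=> k; apply: min_linear_form_gt0.
  - move=> N N0.
    have [k /andP[k0 _] le_k] := dirichlet_linear_form alpha d_gt0 N0.
    exists k => //; apply: le_trans le_k _.
    rewrite lef_pV2 ?posrE ?exprn_gt0 ?ltr0n// -natrX ler_nat.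
    by rewrite -{1}(expn1 N) leq_pexp2l.
  by exists k; apply: next_lt.
have M0 j : (0 < best_M alpha j)%N.
  by elim: j => //= j /ex_next[k /exists_least[[]]].
split=> // j; have [k /exists_least[]] := ex_next _ (M0 j).
rewrite -/(best_M alpha j.+1) => -[M'0 [m [mM' lt_m]]] least_M'; split=> //.
  by apply: le_lt_trans lt_m; rewrite -mM' min_linear_form_le.
move=> n /andP[n0 lt_n]; rewrite leNgt; apply/negP => lt_f.
by have := least_M' _ (next_lt _ _ lt_f n0); lia.
Qed.

Lemma best_q_gt0 j : (0 < best_q alpha j)%N.
Proof. exact: leq_ltn_trans (record_minima_gt j best_q_record_minima). Qed.

Lemma best_M_gt0 j : (0 < best_M alpha j)%N.
Proof. exact: leq_ltn_trans (record_minima_gt j best_M_record_minima). Qed.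

Lemma best_L_gt0 j : 0 < best_L alpha j.
Proof. exact: min_linear_form_gt0 (best_M_gt0 j). Qed.

(** Choose N with N^d < q_(j+1) <= (N+1)^d.  Dirichlet's theorem gives a
    denominator below q_(j+1) with error at most 1/N, hence
    zeta(q_j) <= 1/N, while q_(j+1) <= (2N)^d. *)
Lemma best_q_dirichlet j :
  (best_q alpha j.+1)%:R * sim_dist alpha (best_q alpha j) ^+ d <= 2 ^+ d.
Proof.
have minima := best_q_record_minima.
have lt1 := leq_ltn_trans (best_q_gt0 j) (record_minima_lt j minima).
set Q := best_q alpha j.+1 in lt1 *; set zeta := sim_dist alpha _.
have ex : exists n, (Q <= n.+1 ^ d)%N.
  by exists Q; apply: leq_trans (leq_pexp2l _ d_gt0); rewrite ?expn1.
case: (ex_minnP ex) => N QN Nmin.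
have N0 : (0 < N)%N by case: N QN {Nmin}; rewrite // exp1n; lia.
have NQ : (N ^ d < Q)%N.
  case: N N0 Nmin {QN} => // N _ Nmin.
  by rewrite ltnNge; apply/negP => /Nmin; lia.
have [q /andP[q0 qN] zeta_q] := dirichlet_simultaneous alpha N0.
have zeta_le : zeta <= N%:R^-1.
  apply: le_trans zeta_q; have [_ _ ->] := minima.2 j => //.
  by rewrite q0 (leq_ltn_trans qN NQ).
have zeta0 : 0 <= zeta by apply/ltW/sim_dist_gt0/best_q_gt0.
have N0R : (0 : R) < N%:R by rewrite ltr0n.
have Nz : N%:R * zeta <= 1 by rewrite -ler_pdivlMl// mulr1.
have QR : Q%:R <= (2 * N%:R) ^+ d :> R.
  apply: le_trans (_ : (N.+1%:R) ^+ d <= _); first by rewrite -natrX ler_nat.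
  apply: lerXn2r; rewrite ?nnegrE ?mulr_ge0// -natr1.
  by move: N0; rewrite -(ler_nat R 1); lra.
apply: le_trans (ler_wpM2r (exprn_ge0 _ zeta0) QR) _.
rewrite -exprMn; apply: lerXn2r; rewrite ?nnegrE//; last by lra.
by rewrite !mulr_ge0// ltW.
Qed.

(** Dirichlet's theorem with N = M_(j+1) - 1 gives a vector of norm below
    M_(j+1), so L_j <= N^-d, while M_(j+1) <= 2N. *)
Lemma best_M_dirichlet j :
  (best_M alpha j.+1)%:R ^+ d * best_L alpha j <= 2 ^+ d.
Proof.
have minima := best_M_record_minima.
have lt1 := leq_ltn_trans (best_M_gt0 j) (record_minima_lt j minima).
have [_ _ Lmin] := minima.2 j.
rewrite /best_L; case: (best_M alpha j.+1) lt1 Lmin => // N N0 Lmin.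
have [M /andP[M0 MN] f_le] := dirichlet_linear_form alpha d_gt0 N0.
have L_le := le_trans (Lmin M _) f_le; rewrite M0 in L_le.
have N1 : (1 : R) <= N%:R by rewrite (ler_nat R 1).
apply: le_trans (ler_wpM2l _ (L_le _)) _ => //.
rewrite ler_pdivrMr ?exprn_gt0// ?(lt_le_trans ltr01)// -exprMn.
by apply: lerXn2r; rewrite ?nnegrE// -natr1; lra.
Qed.

(** * The cycle of implications *)

Definition bad_simultaneous := exists2 c : R, 0 < c &
  forall q, (0 < q)%N -> c <= q%:R * sim_dist alpha q ^+ d.

Definition bad_linear_form := exists2 c : R, 0 < c &
  forall M, (0 < M)%N -> c <= M%:R ^+ d * min_linear_form alpha M.

Definition q_ratio_bounded := exists2 K : R, 0 < K &
  forall j, (best_q alpha j.+1)%:R <= K * (best_q alpha j)%:R.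

Definition L_ratio_bounded_below := exists2 k : R, 0 < k &
  forall j, k * best_L alpha j <= best_L alpha j.+1.

Lemma bad_simultaneous_q_ratio_bounded : bad_simultaneous -> q_ratio_bounded.
Proof.
move=> [c c0 bad]; exists (2 ^+ d / c); first by rewrite divr_gt0 ?exprn_gt0.
move=> j; have q0 := best_q_gt0 j.
have zeta0 : 0 < sim_dist alpha (best_q alpha j) ^+ d.
  by rewrite exprn_gt0 ?sim_dist_gt0.
rewrite -(ler_pM2r zeta0); apply: le_trans (best_q_dirichlet j) _.
rewrite -mulrA -mulrA ler_peMr ?exprn_ge0//.
by rewrite ler_pdivlMl// mulr1 bad.
Qed.

Lemma bad_linear_form_L_ratio_bounded_below :
  bad_linear_form -> L_ratio_bounded_below.
Proof.
move=> [c c0 bad]; exists (c / 2 ^+ d); first by rewrite divr_gt0 ?exprn_gt0.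
move=> j; have M0 := best_M_gt0 j.+1.
have MR0 : 0 < (best_M alpha j.+1)%:R ^+ d :> R by rewrite exprn_gt0 ?ltr0n.
rewrite -(ler_pM2l MR0); apply: le_trans (bad _ M0).
rewrite mulrCA mulrAC ler_pdivrMr ?exprn_gt0//.
by rewrite ler_wpM2l ?best_M_dirichlet// ltW.
Qed.

(** The computation shared by the two duality steps, where (y, u) belongs to
    the auxiliary best approximation and (x, v) to the vector under study: raise
    1 <= a x y to the power n, multiply by 1 <= 2 u v, and eliminate y^n u. *)
Lemma exponent_transfer (n : nat) (a x y u v : R) :
  0 <= a -> 0 <= x -> 0 <= y -> 0 <= u -> 0 <= v ->
  1 <= a * x * y -> 1 <= 2 * u * v -> y ^+ n * u <= 2 ^+ n ->
  (2 * (2 * a) ^+ n)^-1 <= x ^+ n * v.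
Proof.
move=> a0 x0 y0 u0 v0 axy uv yu.
have xv0 : 0 <= a ^+ n * x ^+ n * v by rewrite !mulr_ge0// exprn_ge0.
have axyn : 1 <= a ^+ n * x ^+ n * y ^+ n by rewrite -!exprMn exprn_ege1.
have key : 1 <= 2 * (2 * a) ^+ n * (x ^+ n * v).
  apply: le_trans (_ : 2 * (a ^+ n * x ^+ n * v) * (y ^+ n * u) <= _).
    have -> : 2 * (a ^+ n * x ^+ n * v) * (y ^+ n * u) =
      (a ^+ n * x ^+ n * y ^+ n) * (2 * u * v) by ring.
    by rewrite mulr_ege1.
  have -> : 2 * (2 * a) ^+ n * (x ^+ n * v) =
      2 * (a ^+ n * x ^+ n * v) * 2 ^+ n by rewrite exprMn; ring.
  by rewrite ler_wpM2l// mulr_ge0.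
have pos : 0 < 2 * (2 * a) ^+ n.
  rewrite lt_neqAle mulr_ge0 ?exprn_ge0 ?mulr_ge0// andbT eq_sym.
  by apply/eqP => z; move: key; rewrite z mul0r ler10.
by rewrite -(ler_pM2l pos) mulfV// gt_eqF.
Qed.

(** Fix m of norm M with L(m) = delta minimal among such m, and let j be the
    last index with q_j delta < 1/2.  As q_(j+1) delta >= 1/2, the bound on
    ratios keeps q_j delta at least 1/(2K), so [pairing_bound] gives
    1 <= 2 K d M zeta(q_j). *)
Lemma q_ratio_bounded_bad_linear_form : q_ratio_bounded -> bad_linear_form.
Proof.
move=> [K K0 ratio]; pose c : R := (2 * (2 * (2 * K * d%:R)) ^+ d)^-1.
have d0 : (0 : R) < d%:R by rewrite ltr0n.
have c0 : 0 < c by rewrite invr_gt0 !(mulr_gt0, exprn_gt0).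
exists (Num.min c 2^-1) => [|M M0]; first by rewrite lt_min c0 invr_gt0 ltr0n.
have MR : (1 : R) <= M%:R by rewrite (ler_nat R 1).
have := min_linear_form_gt0 d_gt0 indep M0.
have [m mM ->] := min_linear_form_attained alpha M d_gt0.
set delta := linear_form alpha m => delta0.
have minima := best_q_record_minima.
have ex : exists j, 2^-1 <= (best_q alpha j)%:R * delta.
  have := archi_boundP (ltW (etrans (invr_gt0 delta) delta0)).
  set B := Num.bound _ => ltB; exists B.
  have : B%:R <= (best_q alpha B)%:R :> R.
    by rewrite ler_nat ltnW// (record_minima_gt B minima).
  rewrite -ler_pdivrMr//; have : 0 < delta^-1 by rewrite invr_gt0.
  by lra.
rewrite ge_min; case: (ex_minnP ex) => -[|j] large jmin.
  (* Here q_0 = 1, so delta itself is at least 1/2. *)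
  rewrite minima.1 mul1r in large; apply/orP; right.
  by apply: le_trans large _; rewrite ler_peMl ?exprn_ege1// ltW.
have small : (best_q alpha j)%:R * delta <= 2^-1.
  by rewrite leNgt; apply/negP => /ltW/jmin; rewrite ltnn.
have paired := pairing_bound small; rewrite mM -/delta in paired.
apply/orP; left; apply: (@exponent_transfer _ _ M%:R
  (sim_dist alpha (best_q alpha j)) (best_q alpha j.+1)%:R delta) => //.
- by rewrite !mulr_ge0// ltW.
- exact/ltW/sim_dist_gt0/best_q_gt0.
- exact: ltW.
- have := ler_wpM2r (ltW delta0) (ratio j).
  have := ler_wpM2l (ltW K0) paired; lra.
- lra.
- by rewrite mulrC best_q_dirichlet.
Qed.

(** The mirror image: fix q and let j + 1 be the first index with
    q L_(j+1) <= 1/2.  Since q L_j > 1/2, also q L_(j+1) >= k / 2, and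
    [pairing_bound], applied to a vector that attains L_(j+1), gives
    1 <= (2 d / k) M_(j+1) zeta(q). *)
Lemma L_ratio_bounded_below_bad_simultaneous :
  L_ratio_bounded_below -> bad_simultaneous.
Proof.
move=> [k k0 ratio]; pose c : R := (2 * (2 * (2 * d%:R / k)) ^+ d)^-1.
have d0 : (0 : R) < d%:R by rewrite ltr0n.
have c0 : 0 < c by rewrite invr_gt0 !(mulr_gt0, exprn_gt0, invr_gt0).
have L0 := best_L_gt0 0.
exists (Num.min c ((best_L alpha 0 / d%:R) ^+ d)) => [|q q0].
  by rewrite lt_min c0 exprn_gt0// divr_gt0.
have qR : (1 : R) <= q%:R by rewrite (ler_nat R 1).
have zeta0 := sim_dist_gt0 d_gt0 indep q0.
set zeta := sim_dist alpha q in zeta0 *.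
have minima := best_M_record_minima.
have L_small j : best_L alpha j <= 2 ^+ d / j.+1%:R.
  rewrite ler_pdivlMr// mulrC; apply: le_trans (best_M_dirichlet j).
  rewrite ler_pM2r ?best_L_gt0//.
  have := record_minima_gt j.+1 minima; case: (best_M alpha j.+1) => // n jn.
  rewrite -natrX ler_nat; apply: leq_trans (leq_pexp2l _ d_gt0) => //.
  by rewrite expn1; lia.
have ex : exists j, q%:R * best_L alpha j <= 2^-1.
  have B0 : 0 <= 2 * q%:R * 2 ^+ d :> R by rewrite !mulr_ge0 ?exprn_ge0.
  have := archi_boundP B0; set B := Num.bound _ => ltB; exists B.
  apply: le_trans (ler_wpM2l _ (L_small B)) _ => //.
  by rewrite mulrA ler_pdivrMr//; move: ltB; rewrite -[B.+1%:R]natr1; lra.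
rewrite ge_min; case: (ex_minnP ex) => j small jmin.
have [m mM mL] := min_linear_form_attained alpha (best_M alpha j) d_gt0.
have paired : q%:R * best_L alpha j <= d%:R * (best_M alpha j)%:R * zeta.
  by move: small; rewrite /best_L mL -mM; apply: pairing_bound.
case: j small jmin paired {m mM mL} => [|j] small jmin paired.
  (* Here M_0 = 1 and q L_0 is at least L_0, so zeta(q) >= L_0 / d. *)
  apply/orP; right; apply: le_trans (_ : zeta ^+ d <= _); last first.
    by rewrite ler_peMl// exprn_ge0// ltW.
  apply: lerXn2r; rewrite ?nnegrE ?divr_ge0 ?(ltW L0) ?(ltW zeta0)//.
  rewrite ler_pdivrMr// [leRHS]mulrC -(mulr1 d%:R); apply: le_trans paired.
  by rewrite ler_peMl// ltW.
have large : 2^-1 <= q%:R * best_L alpha j.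
  by rewrite leNgt; apply/negP => /ltW/jmin; rewrite ltnn.
apply/orP; left; rewrite mulrC; apply: (@exponent_transfer _ _ zeta
  (best_M alpha j.+1)%:R (best_L alpha j) q%:R) => //.
- by rewrite !mulr_ge0// invr_ge0 ltW.
- exact: ltW.
- exact/ltW/best_L_gt0.
- have -> : 2 * d%:R / k * zeta * (best_M alpha j.+1)%:R =
    2 * (d%:R * (best_M alpha j.+1)%:R * zeta) / k by ring.
  rewrite ler_pdivlMr// mul1r.
  have := ler_wpM2l (ltW (lt_le_trans ltr01 qR)) (ratio j).
  have := ler_wpM2l (ltW k0) large; lra.
- lra.
- exact: best_M_dirichlet.
Qed.

Lemma badly_approximableE : badly_approximable alpha <-> bad_simultaneous.
Proof.
have dn0 : (d%:R : R) != 0 by rewrite pnatr_eq0 -lt0n.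
have rootK (x : R) : 0 <= x -> (x `^ d%:R^-1) ^+ d = x.
  by move=> x0; rewrite -powR_mulrn ?powR_ge0// -powRrM mulVf// powRr1.
have zeta0 q : (0 < q)%N -> 0 <= sim_dist alpha q.
  by move=> q0; apply/ltW/sim_dist_gt0.
split=> [bad|[c c0 bad]]; last first.
  apply: lt_le_trans (_ : c `^ d%:R^-1 <= _); first by rewrite powR_gt0.
  apply: lb_le_inf; first by exists (1%:R `^ d%:R^-1 * sim_dist alpha 1), 1%N.
  move=> _ [q /= q0 <-].
  rewrite -(@ler_pXn2r _ d) ?nnegrE ?mulr_ge0 ?powR_ge0 ?zeta0//.
  by rewrite exprMn !rootK// ?bad// ltW.
exists (inf [set q%:R `^ d%:R^-1 * sim_dist alpha q
            | q in [set q | (0 < q)%N]] ^+ d).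
  by rewrite exprn_gt0.
move=> q q0; rewrite -{1}(rootK q%:R)// -exprMn; apply: lerXn2r.
- by rewrite nnegrE ltW.
- by rewrite nnegrE mulr_ge0 ?powR_ge0 ?zeta0.
apply: ge_inf; last by exists q.
by exists 0 => _ [r /= r0 <-]; rewrite mulr_ge0 ?powR_ge0 ?zeta0.
Qed.

Lemma q_ratio_boundedE :
  (ereal_sup [set ((best_q alpha j.+1)%:R / (best_q alpha j)%:R : R)%:E
               | j in [set: nat]] < +oo)%E <-> q_ratio_bounded.
Proof.
set S := [set _ | _ in _].
have q0 j : (0 : R) < (best_q alpha j)%:R by rewrite ltr0n best_q_gt0.
have ratio_le j : (((best_q alpha j.+1)%:R / (best_q alpha j)%:R : R)%:E
    <= ereal_sup S)%E by apply: ereal_sup_ubound; exists j.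
split=> [fin|[K K0 ratio]]; last first.
  apply: le_lt_trans (ltry K); apply: ge_ereal_sup => _ [j _ <-].
  by rewrite lee_fin ler_pdivrMr.
case: (ereal_sup S) fin ratio_le => // [K _|_ /(_ 0%N)//] ratio_le.
have ratio_leK j : (best_q alpha j.+1)%:R <= K * (best_q alpha j)%:R.
  by rewrite -ler_pdivrMr// -lee_fin.
exists K => //; have := ratio_leK 0%N.
by rewrite best_q_record_minima.1 mulr1; apply: lt_le_trans.
Qed.

Lemma L_ratio_bounded_belowE :
  0 < inf [set best_L alpha j.+1 / best_L alpha j | j in [set: nat]] <->
  L_ratio_bounded_below.
Proof.
set S := [set _ | _ in _].
split=> [inf0|[k k0 ratio]]; last first.
  apply: lt_le_trans k0 (lb_le_inf _ _).
    by exists (best_L alpha 1 / best_L alpha 0), 0%N.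
  by move=> _ [j _ <-]; rewrite ler_pdivlMr ?best_L_gt0.
exists (inf S) => // j; rewrite -ler_pdivlMr ?best_L_gt0//.
apply: ge_inf; last by exists j.
by exists 0 => _ [i _ <-]; rewrite divr_ge0// ltW// best_L_gt0.
Qed.

End BestApproximations.

Theorem theorem1 (R : realType) (d : nat) (hd : (1 <= d)%N)
    (alpha : 'rV[R]_d) (halpha : Q_independent_with_1 alpha) :
  (badly_approximable alpha <->
   (ereal_sup [set ((best_q alpha j.+1)%:R / (best_q alpha j)%:R : R)%:E
               | j in [set: nat]] < +oo)%E) /\
  ((ereal_sup [set ((best_q alpha j.+1)%:R / (best_q alpha j)%:R : R)%:E
               | j in [set: nat]] < +oo)%E <->
   0 < inf [set best_L alpha j.+1 / best_L alpha j | j in [set: nat]]).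
Proof.
rewrite (badly_approximableE hd halpha) (q_ratio_boundedE hd halpha).
rewrite (L_ratio_bounded_belowE hd halpha).
have sim_q := bad_simultaneous_q_ratio_bounded hd halpha.
have q_lin := q_ratio_bounded_bad_linear_form hd halpha.
have lin_L := bad_linear_form_L_ratio_bounded_below hd halpha.
have L_sim := L_ratio_bounded_below_bad_simultaneous hd halpha.
by split; split=> // ?; auto.
Qed.
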